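(* Let $G=(V,E)$ be a finite graph with $n=|V|$, $m=|E|$, and let $0<p\le 1/2$. Then there is a collection of paths $\Gamma_{worm}=\{\gamma_{xy}\mid x,y\in\Omega_0\}$, where each $\gamma_{xy}$ is a sequence of subsets of $E$ starting at $x$ and ending at $y$ in which consecutive states differ in exactly one edge, with weights $wt(\gamma_{xy})=\pi_{even}(x)\pi_{even}(y)$, such that: every state $w$ of every $\gamma\in\Gamma_{worm}$ lies in $\Omega_{worm}$; each state appears at most once in each $\gamma$; every path has length at most $m$; and for any transition $(w,w')$ with $w'=w\oplus\{e\}$ for an edge $e$, $$\sum_{\gamma\ni(w,w')}wt(\gamma)\le n^4\pi_{worm}(w).$$ Moreover, in the special case $w'=w\cup\{e\}$ with $e\notin w$, $$\sum_{\gamma\ni(w,w')}wt(\gamma)\le n^4\pi_{worm}(w)\frac{p}{1-p}.$$ Here the sums are over paths in $\Gamma_{worm}$ containing the transition $(w,w')$ as a consecutive pair.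
   Context: For $k\ge0$, $\Omega_k$ is the set of subsets $S\subseteq E$ such that exactly $k$ vertices have odd degree in $(V,S)$; $\Omega_0$ is the set of even subgraphs and $\Omega_{worm}=\Omega_0\cup\Omega_2$. For $S\subseteq E$ let $w_p(S)=p^{|S|}(1-p)^{|E\setminus S|}$. The even subgraph measure is $\pi_{even}(S)=w_p(S)/\sum_{T\in\Omega_0}w_p(T)$ for $S\in\Omega_0$. Define $w_{worm}(S)=w_p(S)$ if $S\in\Omega_0$, $w_{worm}(S)=n^{-2}w_p(S)$ if $S\in\Omega_2$, and $0$ otherwise; the worm measure is $\pi_{worm}(S)=w_{worm}(S)/\sum_{T\in\Omega_{worm}}w_{worm}(T)$. $\oplus$ denotes symmetric difference. *)

(* Defs.v *)
From mathcomp Require Import all_boot all_order all_algebra.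

Set Implicit Arguments.
Unset Strict Implicit.
Unset Printing Implicit Defensive.

Import Order.TTheory GRing.Theory Num.Theory.
Local Open Scope ring_scope.

(* Finite undirected graphs; parallel edges and loops are allowed. The order of
   the two ends of an edge is an artefact of the encoding: everything below
   depends on the ends only through [degree], which is symmetric in them. A
   simple graph is the case of distinct ends and no repeated pair of ends. *)
Record graph := Graph {
  vertex : finType;
  edge : finType;
  ends : edge -> vertex * vertex
}.

Section Worm.
Variable G : graph.
Implicit Types (S T w x y : {set edge G}) (s : seq {set edge G}).

(* The degree of [v] in [(V, S)]; a loop at [v] counts twice. *)
Definition degree S (v : vertex G) : nat :=
  (#|[set e in S | (ends e).1 == v]| + #|[set e in S | (ends e).2 == v]|)%N.

Definition Omega (k : nat) : {set {set edge G}} :=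
  [set S : {set edge G} | #|[set v | odd (degree S v)]| == k].

Definition Omega_worm : {set {set edge G}} := Omega 0 :|: Omega 2.

Definition symdiff S T : {set edge G} := (S :\: T) :|: (T :\: S).

Definition edge_flip S T : bool := #|symdiff S T| == 1%N.

(* [s] lists all the states of the path, both end points included, so that
   the length of the path is [path_length s] and not [size s]. *)
Definition path_from_to x y s : bool :=
  [&& ohead s == Some x, last x s == y & sorted edge_flip s].

Definition path_length s : nat := (size s).-1.

(* [infix] asks for a contiguous subsequence. *)
Definition uses_transition s w (w' : {set edge G}) : bool := infix [:: w; w'] s.

Variables (R : realFieldType) (p : R).

Definition w_p S : R := p ^+ #|S| * (1 - p) ^+ #|~: S|.

Definition pi_even S : R :=
  if S \in Omega 0 then w_p S / \sum_(T in Omega 0) w_p T else 0.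

Definition w_worm S : R :=
  if S \in Omega 0 then w_p S
  else if S \in Omega 2 then #|vertex G|%:R ^- 2 * w_p S
  else 0.

Definition pi_worm S : R := w_worm S / \sum_(T in Omega_worm) w_worm T.

(* The total weight of the paths of the family [gamma], indexed by pairs of
   even subgraphs, that use a transition; values of [gamma] outside
   [Omega 0] are irrelevant. *)
Definition congestion (gamma : {set edge G} -> {set edge G} -> seq {set edge G})
    w (w' : {set edge G}) : R :=
  \sum_(x in Omega 0) \sum_(y in Omega 0 | uses_transition (gamma x y) w w')
    pi_even x * pi_even y.

End Worm.

(* Main.v *)
Require Import Defs.
From mathcomp Require Import all_boot all_order all_algebra.
From mathcomp Require Import ring lra zify.

(* The path from x to y flips the edges of D = x (+) y one at a time, in an
   order that depends on D only and along which the edges left to flip never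
   have more than two odd vertices. A transition (w, w') together with
   T = D (+) w determines D, hence the position in the order, hence x and y;
   moreover w_p(x) w_p(y) = w_p(w) w_p(T). As T has the same odd vertices as w,
   the congestion is at most w_p(w) Z_B / Z_0^2, where B is the set of odd
   vertices of w and Z_B the total weight of the sets with odd vertices B. The
   high-temperature expansion of the Ising model gives Z_B <= Z_0 for p <= 1/2,
   which also bounds the normalisation of the worm measure by n^2 Z_0. When e is
   added, T contains e, and encoding by T minus e gains the factor p/(1-p). *)

Set Implicit Arguments.
Unset Strict Implicit.
Unset Printing Implicit Defensive.

Import Order.TTheory GRing.Theory Num.Theory.
Local Open Scope ring_scope.

(** * Odd vertices of edge sets *)

Section OddVertices.
Variable G : graph.
Implicit Types (S T w x y Q : {set edge G}) (e : edge G) (u v : vertex G).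

Lemma in_symdiff S T e : (e \in symdiff S T) = (e \in S) (+) (e \in T).
Proof. by rewrite !inE; case: (e \in S); case: (e \in T). Qed.

Lemma symdiffC S T : symdiff S T = symdiff T S.
Proof. by apply/setP=> e; rewrite !in_symdiff addbC. Qed.

Lemma symdiffA : associative (@symdiff G).
Proof. by move=> S T U; apply/setP=> e; rewrite !in_symdiff addbA. Qed.

Lemma symdiffK S : involutive (symdiff S).
Proof. by move=> T; apply/setP=> e; rewrite !in_symdiff addKb. Qed.

Lemma symdiff0 S : symdiff S set0 = S.
Proof. by apply/setP=> e; rewrite in_symdiff inE addbF. Qed.

Lemma setD1_symdiff S e : e \in S -> S :\ e = symdiff S [set e].
Proof.
move=> eS; apply/setP=> f; rewrite in_symdiff !inE.
by case: eqVneq => [->|]; rewrite ?eS // addbF.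
Qed.

Lemma setU1_symdiff S e : e \notin S -> S :|: [set e] = symdiff S [set e].
Proof.
move=> eS; apply/setP=> f; rewrite in_symdiff !inE.
by case: eqVneq => [->|]; rewrite ?(negPf eS) ?orbF ?addbF.
Qed.

(** The contribution of [e] to the degree of [v] modulo 2, so a loop counts for nothing. *)
Definition incident e v : bool := ((ends e).1 == v) (+) ((ends e).2 == v).

(** The boundary of [S] over the field with two elements, hence additive for [symdiff]. *)
Definition odds S : {set vertex G} := [set v | odd (degree S v)].

Lemma in_odds S v : (v \in odds S) = \big[addb/false]_(e in S) incident e v.
Proof.
have oddE (P : pred (edge G)) :
    odd #|[set e in S | P e]| = \big[addb/false]_(e in S) P e.
  rewrite -sum1dep_card (big_morph odd oddD (erefl _)) big_mkcondr.
  by apply: eq_bigr => e _; case: (P e).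
by rewrite inE oddD !oddE -big_split.
Qed.

Lemma odds_symdiff S T v :
  (v \in odds (symdiff S T)) = (v \in odds S) (+) (v \in odds T).
Proof.
rewrite !in_odds big_mkcond [X in X (+) _]big_mkcond [X in _ (+) X]big_mkcond.
rewrite -big_split; apply: eq_bigr => e _ /=; rewrite in_symdiff.
by case: (e \in S); case: (e \in T); case: (incident e v).
Qed.

Lemma odds_set1 e v : (v \in odds [set e]) = incident e v.
Proof. by rewrite in_odds big_set1. Qed.

Lemma in_Omega S k : (S \in Omega G k) = (#|odds S| == k).
Proof. by rewrite inE. Qed.

Lemma in_Omega0 S : (S \in Omega G 0) = (odds S == set0).
Proof. by rewrite in_Omega cards_eq0. Qed.

Lemma in_Omega_worm S :
  (S \in Omega_worm G) = (#|odds S| == 0%N) || (#|odds S| == 2).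
Proof. by rewrite in_setU !in_Omega. Qed.

Lemma Omega_worm_odds S T :
  odds S = odds T -> (S \in Omega_worm G) = (T \in Omega_worm G).
Proof. by move=> eST; rewrite !in_Omega_worm eST. Qed.

(** The vertices [u] and [u'] may coincide, which covers loops and the case where a moved odd end
    meets the other one. *)
Lemma Omega_worm_pair S u u' :
  (forall v, (v \in odds S) = (u == v) (+) (u' == v)) -> S \in Omega_worm G.
Proof.
move=> oddsE; rewrite in_Omega_worm; have [eu | neq_u] := eqVneq u u'.
  by rewrite cards_eq0 orbC; apply/orP; right; apply/eqP/setP=> v;
     rewrite oddsE eu addbb inE.
have -> : odds S = [set u; u'].
  apply/setP=> v; rewrite oddsE !inE ![_ == v]eq_sym.
  by case: (eqVneq v u) => [->|]; rewrite ?(negPf neq_u).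
by rewrite cards2 neq_u orbT.
Qed.

Lemma odds_even_symdiff S T :
  S \in Omega G 0 -> odds (symdiff S T) = odds T.
Proof.
by rewrite in_Omega0 => /eqP S0; apply/setP=> v; rewrite odds_symdiff S0 inE.
Qed.

Lemma Omega0_symdiff S T :
  S \in Omega G 0 -> T \in Omega G 0 -> symdiff S T \in Omega G 0.
Proof. by move=> S0; rewrite !in_Omega0 odds_even_symdiff. Qed.

(* An even set loses any edge; otherwise one walks away from an odd vertex [a]
   along an edge that is not a loop, which moves the odd end to its other end. *)
Lemma Omega_worm_removable Q :
    Q \in Omega_worm G -> Q != set0 ->
  exists2 e, e \in Q & Q :\ e \in Omega_worm G.
Proof.
rewrite in_Omega_worm => /orP[| /cards2P[a [b [neq_ab oddsQ]]] _].
  rewrite -in_Omega => Q0 /set0Pn[e eQ]; exists e => //.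
  rewrite setD1_symdiff // (Omega_worm_odds (odds_even_symdiff _ Q0)).
  by apply: (@Omega_worm_pair _ (ends e).1 (ends e).2) => v; rewrite odds_set1.
have [e eQ a_e] : exists2 e, e \in Q & incident e a.
  apply/exists_inP/contraT => /exists_inPn no_e.
  have: a \in odds Q by rewrite oddsQ !inE eqxx.
  by rewrite in_odds big1 // => e /no_e/negPf.
exists e => //; rewrite setD1_symdiff //.
have [c e_ac] : exists c, forall v, incident e v = (a == v) (+) (c == v).
  move: a_e; rewrite /incident; case: eqVneq => [<- _|_ /= /eqP<-].
    by exists (ends e).2.
  by exists (ends e).1 => v; rewrite addbC.
apply: (@Omega_worm_pair _ b c) => v; rewrite odds_symdiff odds_set1 e_ac.
rewrite oddsQ !inE ![v == _]eq_sym; case: eqVneq => //= av.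
by rewrite -av [b == a]eq_sym (negPf neq_ab) negbK.
Qed.

End OddVertices.

(** * Removing the edges of a set one at a time *)

Section Peeling.
Variable G : graph.
Implicit Types (S T w x y Q A B : {set edge G}) (s : seq {set edge G}).

Definition removes_edge Q Q' : bool := [exists e in Q, Q' == Q :\ e].

Lemma removes_edgeW Q Q' : removes_edge Q Q' -> Q' \proper Q.
Proof. by case/exists_inP=> e eQ /eqP->; exact: properD1. Qed.

Lemma removes_edge_card Q Q' : removes_edge Q Q' -> #|Q| = #|Q'|.+1.
Proof. by case/exists_inP=> e eQ /eqP->; rewrite (cardsD1 e Q) eQ. Qed.

Definition superset Q Q' : bool := Q' \subset Q.

Lemma path_superset Q s : path removes_edge Q s -> all (superset Q) s.
Proof.
move=> Qs; apply: order_path_min => [S T U sST sTU|].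
  exact: subset_trans sTU sST.
by apply: sub_path Qs => S T /removes_edgeW/proper_sub.
Qed.

Lemma path_removes_edge_uniq Q s : path removes_edge Q s -> uniq (Q :: s).
Proof.
move=> Qs; apply: (@sorted_uniq _ (fun S T => T \proper S)) => [S T U sST sTU|S|].
- exact: proper_trans sTU sST.
- exact: properxx.
by apply: sub_path Qs => S T /removes_edgeW.
Qed.

Lemma path_removes_edge_size Q s :
  path removes_edge Q s -> (size s + #|last Q s| = #|Q|)%N.
Proof.
elim: s Q => [|Q' s IHs] Q //= /andP[/removes_edge_card-> /IHs<-].
by rewrite addSn.
Qed.

(** The sets decrease along the path, so an edge, once removed, is missing from all later sets: it
    is removed at one step only. *)
Lemma removal_unique Q s A A' B B' e :
    path removes_edge Q s ->
    infix [:: A; A'] (Q :: s) -> infix [:: B; B'] (Q :: s) ->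
    e \in A -> e \notin A' -> e \in B -> e \notin B' ->
  A = B.
Proof.
move=> Qs iA iB eA eA' eB eB'; elim: s Q Qs iA iB => [|Q' s IHs] Q.
  by rewrite /= andbF.
rewrite [path _ _ _]/= => /andP[_ Q's]; rewrite ![infix _ (Q :: _)]infix_consl.
have below S S' : infix [:: S; S'] (Q' :: s) -> S \subset Q'.
  move=> /consr_infix; rewrite infix1s in_cons => /predU1P[->//|].
  exact: (allP (path_superset Q's)).
case/orP=> [|iA].
  rewrite /= => /and3P[/eqP-> /eqP eA'Q' _].
  case/orP=> [/= /and3P[/eqP-> _ _] //|iB].
  by rewrite eA'Q' (subsetP (below _ _ iB)) in eA'.
case/orP=> [|iB]; last exact: IHs iB.
rewrite /= => /and3P[_ /eqP eB'Q' _].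
by rewrite eB'Q' (subsetP (below _ _ iA)) in eB'.
Qed.

Lemma peeling_exists Q : Q \in Omega_worm G ->
  exists s, [/\ path removes_edge Q s, last Q s = set0
              & {subset Q :: s <= Omega_worm G}].
Proof.
have [n] := ubnP #|Q|; elim: n Q => // n IHn Q leQn QW.
have [-> | Q0] := eqVneq Q set0.
  exists [::]; split=> // S; rewrite inE => /eqP->.
  rewrite in_Omega_worm cards_eq0; apply/orP; left; apply/eqP/setP=> v.
  by rewrite in_odds big_set0 inE.
have [e eQ QeW] := Omega_worm_removable QW Q0.
have [|s [Qs sl sW]] := IHn (Q :\ e) _ QeW.
  by rewrite (cardsD1 e Q) eQ in leQn.
exists (Q :\ e :: s); split=> //=.
  by rewrite Qs andbT; apply/exists_inP; exists e.
by move=> S; rewrite in_cons => /predU1P[->|/sW].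
Qed.

End Peeling.

Lemma infix_map (T T' : eqType) (f : T -> T') (s1 s2 : seq T) :
  infix s1 s2 -> infix (map f s1) (map f s2).
Proof.
case/infixP=> s [s' ->]; apply/infixP; exists (map f s), (map f s').
by rewrite !map_cat.
Qed.

(** * Canonical paths and their encoding *)

Section CanonicalPaths.
Variable G : graph.
Implicit Types (S T w x y Q A B D : {set edge G}).

Variable tail : {set edge G} -> seq {set edge G}.
Hypothesis tailP : forall D, D \in Omega G 0 ->
  [/\ path (@removes_edge G) D (tail D), last D (tail D) = set0
    & {subset D :: tail D <= Omega_worm G}].

(* The set [Q] of the edges of [x (+) y] still to be flipped runs through a
   peeling of [x (+) y], and the current state is [y (+) Q]. *)
Definition canonical_path x y : seq {set edge G} :=
  let D := symdiff x y in map (symdiff y) (D :: tail D).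

(** Adding the even set [y] changes no odd vertex, so the states inherit membership in [Omega_worm]
    from the peeling; the length is the cardinal of [symdiff x y]. *)
Lemma canonical_pathP x y : x \in Omega G 0 -> y \in Omega G 0 ->
  [/\ path_from_to x y (canonical_path x y),
      {subset canonical_path x y <= Omega_worm G},
      uniq (canonical_path x y)
    & (path_length (canonical_path x y) <= #|edge G|)%N].
Proof.
move=> x0 y0; have [Ds Dl DW] := tailP (Omega0_symdiff x0 y0).
have yDx : symdiff y (symdiff x y) = x by rewrite [symdiff x y]symdiffC symdiffK.
split.
- apply/and3P; split; first by rewrite /= yDx.
    by rewrite /= last_map Dl symdiff0.
  rewrite /canonical_path sorted_map; apply: sub_path Ds => S T /=.
  case/exists_inP=> e eS /eqP->; rewrite /edge_flip setD1_symdiff //.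
  rewrite [symdiff y S]symdiffC -symdiffA symdiffK.
  by rewrite symdiffK cards1.
- move=> _ /mapP[S /DW SW ->].
  by rewrite (Omega_worm_odds (odds_even_symdiff _ y0)).
- rewrite map_inj_uniq ?path_removes_edge_uniq //; exact: inv_inj (symdiffK y).
rewrite /path_length /= size_map.
by rewrite -(leq_add2r #|last (symdiff x y) (tail (symdiff x y))|)
           (path_removes_edge_size Ds) Dl cards0 addn0 max_card.
Qed.

Lemma uses_transition_peeling x y w w' :
    uses_transition (canonical_path x y) w w' ->
  infix [:: symdiff y w; symdiff y w'] (symdiff x y :: tail (symdiff x y)).
Proof.
move=> /(@infix_map _ _ (symdiff y)); rewrite -map_comp.
by rewrite (eq_map (symdiffK y)) map_id.
Qed.

Lemma uses_transition_removes x y w w' :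
    x \in Omega G 0 -> y \in Omega G 0 ->
    uses_transition (canonical_path x y) w w' ->
  [/\ removes_edge (symdiff y w) (symdiff y w'),
      symdiff y w \subset symdiff x y, w \in Omega_worm G & w' \in Omega_worm G].
Proof.
move=> x0 y0; have [Ds _ DW] := tailP (Omega0_symdiff x0 y0).
move=> /uses_transition_peeling ww'.
have yD S : symdiff y S \in symdiff x y :: tail (symdiff x y) ->
    symdiff y S \subset symdiff x y /\ S \in Omega_worm G.
  move=> yS; split; last first.
    by move/DW: yS; rewrite (Omega_worm_odds (odds_even_symdiff _ y0)).
  move: yS; rewrite in_cons => /predU1P[-> //|].
  exact: (allP (path_superset Ds)).
have [|wD wW] := yD w; first by rewrite -infix1s (consr_infix ww').
have [|_ w'W] := yD w'.
  by rewrite -infix1s (consr_infix (consl_infix ww')).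
split=> //; case/infixP: ww' => s1 [s2 eD].
have: sorted (@removes_edge G) (symdiff x y :: tail (symdiff x y)) by [].
by rewrite eD => /cat_sorted2[_ /= /andP[]].
Qed.

(* [T] fixes [x (+) y], hence the peeling; the edge [e] fixes the point of the
   peeling at which the transition occurs, hence [y (+) w]. *)
Lemma transition_encoding_inj x y x' y' w e T :
    x \in Omega G 0 -> y \in Omega G 0 -> x' \in Omega G 0 -> y' \in Omega G 0 ->
    uses_transition (canonical_path x y) w (symdiff w [set e]) ->
    uses_transition (canonical_path x' y') w (symdiff w [set e]) ->
    symdiff (symdiff x y) T = symdiff (symdiff x' y') T ->
  x = x' /\ y = y'.
Proof.
move=> x0 y0 x0' y0' xy xy'.
rewrite ![symdiff _ T]symdiffC => /(inv_inj (symdiffK T)) eD.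
have removed z z' : z \in Omega G 0 -> z' \in Omega G 0 ->
    uses_transition (canonical_path z z') w (symdiff w [set e]) ->
    e \in symdiff z' w /\ e \notin symdiff z' (symdiff w [set e]).
  move=> z0 z0' /(uses_transition_removes z0 z0')[+ _ _ _].
  (* The two sets differ at [e] only, so the removed edge [f] is [e]. *)
  case/removes_edgeW/properP=> _ [f]; rewrite !in_symdiff !inE !addbA.
  by have [<-|_] := eqVneq f e; rewrite ?eqxx => ->.
have [eA eA'] := removed _ _ x0 y0 xy; have [eB eB'] := removed _ _ x0' y0' xy'.
have [Ds _ _] := tailP (Omega0_symdiff x0 y0).
have eyw : symdiff y w = symdiff y' w.
  apply: removal_unique Ds _ _ eA eA' eB eB'; first exact: uses_transition_peeling.
  rewrite eD; exact: uses_transition_peeling.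
have eyy' : y = y'.
  by apply: (inv_inj (symdiffK w)); rewrite ![symdiff w _]symdiffC.
split=> //; apply: (inv_inj (symdiffK y)).
by rewrite ![symdiff y _]symdiffC eD eyy'.
Qed.

End CanonicalPaths.

(** * Weights and the high-temperature expansion *)

Section Weights.
Variables (R : realFieldType) (G : graph) (p : R).
Hypotheses (p_gt0 : 0 < p) (p_le_half : p <= 1 / 2).
Implicit Types (S T w x y Q A D : {set edge G}) (B U : {set vertex G}).

Lemma w_p_prod S : w_p p S = \prod_e (if e \in S then p else 1 - p).
Proof.
rewrite big_if /= /w_p !prodr_const; congr (_ ^+ _ * _ ^+ _).
by apply: eq_card => e; rewrite !inE.
Qed.

Lemma one_minus_p_gt0 : 0 < 1 - p.
Proof. by move: p_le_half; lra. Qed.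

Lemma w_p_gt0 S : 0 < w_p p S.
Proof. by rewrite /w_p mulr_gt0 ?exprn_gt0 ?one_minus_p_gt0. Qed.

Lemma w_p_ge0 S : 0 <= w_p p S.
Proof. exact/ltW/w_p_gt0. Qed.

(** At an edge of [symdiff x y], the set [w] agrees with exactly one of [x] and [y], and the
    encoding with the other; at any other edge the inclusion makes all four agree. *)
Lemma w_pM x y w : symdiff y w \subset symdiff x y ->
  w_p p x * w_p p y = w_p p w * w_p p (symdiff (symdiff x y) w).
Proof.
move=> /subsetP ywD; rewrite !w_p_prod -!big_split; apply: eq_bigr => e _ /=.
move/implyP: (ywD e); rewrite !in_symdiff.
by case: (e \in x); case: (e \in y); case: (e \in w) => //= _; rewrite mulrC.
Qed.

Lemma w_pD1 S e : e \in S -> w_p p S = w_p p (S :\ e) * (p / (1 - p)).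
Proof.
move=> eS; have q0 := lt0r_neq0 one_minus_p_gt0.
have cS : #|S| = #|S :\ e|.+1 by rewrite (cardsD1 e S) eS.
have cSC : #|~: (S :\ e)| = #|~: S|.+1.
  rewrite (cardsD1 e) !inE eqxx add1n; congr _.+1; apply: eq_card => f.
  by rewrite !inE; case: eqVneq => //= ->; rewrite eS.
rewrite /w_p cS cSC !exprS; set a := _ ^+ _; set b := _ ^+ _.
by field.
Qed.

Definition Z B : R := \sum_(S : {set edge G} | odds S == B) w_p p S.

Lemma ZOmega0 : \sum_(T in Omega G 0) w_p p T = Z set0.
Proof. by apply: eq_bigl => T; rewrite in_Omega0. Qed.

Lemma Z0_gt0 : 0 < Z set0.
Proof.
have e0 : odds (set0 : {set edge G}) == set0.
  by apply/eqP/setP=> v; rewrite in_odds big_set0 inE.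
rewrite /Z (bigD1 set0) //=.
by rewrite ltr_wpDr ?w_p_gt0 // sumr_ge0 // => S _; apply: w_p_ge0.
Qed.

(* The Ising interaction of the ends of [e] when the spin is [-1] on [U]. *)
Definition spin U (e : edge G) : R :=
  (-1) ^+ (((ends e).1 \in U) (+) ((ends e).2 \in U)).

Lemma addb_pred1 U (u : vertex G) : \big[addb/false]_(v in U) (u == v) = (u \in U).
Proof.
have [uU | uU] := boolP (u \in U); last first.
  by rewrite big1 // => v vU; apply: contraNF uU => /eqP->.
rewrite (bigD1 u) //= eqxx big1 // => v /andP[_].
by rewrite eq_sym => /negPf.
Qed.

(** Both sides are -1 to the number of pairs of [e] in [S] and [v] in [U] with [incident e v]. *)
Lemma prod_spin U S :
  \prod_(e in S) spin U e = \prod_(v in U) (-1) ^+ (v \in odds S).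
Proof.
pose sgn (b : bool) : R := (-1) ^+ b.
have sgnE := big_morph sgn (signr_addb R) (erefl (sgn false)).
rewrite -[LHS]sgnE -[RHS]sgnE; congr sgn.
under [RHS]eq_bigr do rewrite in_odds.
rewrite [RHS]exchange_big; apply: eq_bigr => e _ /=.
by rewrite /incident big_split /= !addb_pred1.
Qed.

(** The sum is the expansion of a product over all vertices, in which the factor of a vertex of [B]
    is [-1 + 1]. *)
Lemma sum_signs B :
  \sum_(U : {set vertex G}) \prod_(v in U) (-1) ^+ (v \in B)
  = if B == set0 then 2 ^+ #|vertex G| else 0 :> R.
Proof.
have -> : \sum_(U : {set vertex G}) \prod_(v in U) (-1) ^+ (v \in B)
    = \prod_(v : vertex G) ((-1) ^+ (v \in B) + 1) :> R.
  by rewrite bigA_distr; apply: eq_bigr => U _; rewrite big_mkcond.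
case: ifP => [/eqP->|/negbT/set0Pn[v vB]].
  by under eq_bigr do rewrite inE; rewrite prodr_const.
by rewrite (bigD1 v) //= vB expr1 addNr mul0r.
Qed.

(* High-temperature expansion: [Z B / Z set0] is the expectation of the product
   of the spins in [B] for a ferromagnetic Ising model with
   [tanh beta = p / (1 - p)], hence is at most [1]. *)
Lemma Z_le B : Z B <= Z set0.
Proof.
pose W U := \prod_e (p * spin U e + (1 - p)).
have spinE U e : spin U e = 1 \/ spin U e = -1.
  by rewrite /spin; case: (_ (+) _); [right | left].
have W_ge0 U : 0 <= W U.
  apply: prodr_ge0 => e _; have q0 := ltW one_minus_p_gt0.
  (* The factor is 1 or [1 - 2 * p]; the latter is nonnegative because [p <= 1 / 2]. *)
  by case: (spinE U e) => ->; move: p_gt0 p_le_half q0; lra.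
have WE U : W U = \sum_S w_p p S * \prod_(v in U) (-1) ^+ (v \in odds S).
  rewrite /W bigA_distr; apply: eq_bigr => S _.
  rewrite -prod_spin w_p_prod [X in _ = _ * X]big_mkcond -big_split.
  by apply: eq_bigr => e _ /=; case: ifP; rewrite ?mulr1.
(* Fourier inversion: by [sum_signs], summing over [U] keeps only the sets [S] with [odds S = C]. *)
have ZE C : 2 ^+ #|vertex G| * Z C
    = \sum_U W U * \prod_(v in U) (-1) ^+ (v \in C).
  under eq_bigr do rewrite WE mulr_suml.
  rewrite exchange_big /Z mulr_sumr big_mkcond; apply: eq_bigr => S _ /=.
  under eq_bigr do rewrite -mulrA -big_split /=.
  rewrite -mulr_sumr.
  pose D := [set v | (v \in odds S) (+) (v \in C)].
  have -> : \sum_(U : {set vertex G})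
      \prod_(v in U) ((-1) ^+ (v \in odds S) * (-1) ^+ (v \in C))
      = if D == set0 then 2 ^+ #|vertex G| else 0 :> R.
    rewrite -sum_signs; apply: eq_bigr => U _; apply: eq_bigr => v _.
    by rewrite -signr_addb [in RHS]in_set.
  have -> : (D == set0) = (odds S == C).
    rewrite /D; apply/eqP/eqP => [/setP D0|<-]; apply/setP=> v; last first.
      by rewrite !inE addbb.
    by have:= D0 v; rewrite !inE; case: odd; case: (v \in C).
  by case: ifP; rewrite ?mulr0 // mulrC.
rewrite -(ler_pM2l (_ : 0 < 2 ^+ #|vertex G|)) ?exprn_gt0 ?ltr0n // !ZE.
apply: ler_sum => U _.
(* The product of signs is 1 on the right and has absolute value 1 on the left. *)
rewrite [X in _ <= _ * X]big1 ?mulr1 => [|v _]; last by rewrite inE.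
apply: ler_piMr => //; apply: le_trans (ler_norm _) _.
by rewrite normr_prod big1 // => v _; rewrite normrX normrN1 expr1n.
Qed.

Definition Zworm : R := \sum_(T in Omega_worm G) w_worm p T.

Lemma ZwormE :
  Zworm = Z set0 + #|vertex G|%:R ^- 2 * \sum_(T in Omega G 2) w_p p T.
Proof.
have dis : [disjoint Omega G 0 & Omega G 2].
  by apply/pred0P=> T /=; rewrite !in_Omega; case: eqP => // ->.
rewrite /Zworm (eq_bigl [predU Omega G 0 & Omega G 2]) => [|T]; last first.
  by rewrite !inE.
rewrite bigU //= -ZOmega0 mulr_sumr; congr (_ + _).
  by apply: eq_bigr => T T0; rewrite /w_worm T0.
apply: eq_bigr => T T2; rewrite /w_worm T2 ifF //.
by apply/negP=> T0; have /pred0P/(_ T) := dis; rewrite /= T0 T2.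
Qed.

Lemma Zworm_gt0 : 0 < Zworm.
Proof.
rewrite ZwormE ltr_wpDr ?Z0_gt0 // mulr_ge0 ?invr_ge0 ?exprn_ge0 //.
by apply: sumr_ge0 => S _; apply: w_p_ge0.
Qed.

(** By [Z_le], each of the ['C(n, 2)] possible pairs of odd vertices contributes at most
    [Z set0]. *)
Lemma Zworm_le : (0 < #|vertex G|)%N -> Zworm <= #|vertex G|%:R ^+ 2 * Z set0.
Proof.
set n := #|vertex G| => n0.
have Z2 : \sum_(T in Omega G 2) w_p p T <= 'C(n, 2)%:R * Z set0.
  rewrite (partition_big (@odds G) (fun B => #|B| == 2%N)) => [|T]; last first.
    by rewrite in_Omega.
  rewrite -card_draws mulr_natl -sumr_const [leRHS]big_mkcond [leLHS]big_mkcond.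
  apply: ler_sum => B _; rewrite inE; case: eqP => // B2.
  apply: le_trans (Z_le B); rewrite le_eqVlt; apply/orP; left; apply/eqP.
  apply: eq_bigl => S; rewrite in_Omega.
  by case: (eqVneq (odds S) B) => [->|]; rewrite ?andbF // B2.
rewrite ZwormE; set N : R := n%:R.
have N2 : 0 < N ^+ 2 by rewrite exprn_gt0 ?ltr0n.
rewrite -/n -/N -(ler_pM2l N2) mulrDr mulVKf ?lt0r_neq0 //.
apply: le_trans (lerD (lexx _) Z2) _; rewrite -mulrDl mulrA.
apply: ler_wpM2r; first exact/ltW/Z0_gt0.
(* What remains is [n ^ 2 + 'C(n, 2) <= n ^ 4], an equality at [n = 1]. *)
rewrite /N -!natrX -natrD -natrM ler_nat.
by rewrite bin2; nia.
Qed.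

Lemma w_worm_ge0 S : 0 <= w_worm p S.
Proof.
rewrite /w_worm; case: ifP => _; first exact: w_p_ge0.
by case: ifP => _ //; rewrite mulr_ge0 ?w_p_ge0 ?invr_ge0 ?exprn_ge0.
Qed.

Lemma w_p_le_worm w : (0 < #|vertex G|)%N -> w \in Omega_worm G ->
  w_p p w <= #|vertex G|%:R ^+ 2 * w_worm p w.
Proof.
set n := #|vertex G| => n0; rewrite in_setU /w_worm.
have N2 : 1 <= n%:R ^+ 2 :> R by rewrite -natrX ler1n expn_gt0 n0.
case: ifP => _ /=; first by rewrite ler_peMl ?w_p_ge0.
move=> ->; rewrite mulVKf //.
by rewrite lt0r_neq0 // (lt_le_trans ltr01).
Qed.

Lemma pi_worm_ge0 w : 0 <= pi_worm p w.
Proof. by rewrite divr_ge0 ?w_worm_ge0 ?(ltW Zworm_gt0). Qed.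

(** One factor [n ^ 2] pays for the reduced weight on [Omega G 2], the other for the normalisation
    [Zworm]. *)
Lemma w_p_le_pi_worm w : (0 < #|vertex G|)%N -> w \in Omega_worm G ->
  w_p p w / Z set0 <= #|vertex G|%:R ^+ 4 * pi_worm p w.
Proof.
set n := #|vertex G| => n0 wW.
rewrite ler_pdivrMr ?Z0_gt0 // /pi_worm -/Zworm.
apply: le_trans (w_p_le_worm n0 wW) _.
have le_N := Zworm_le n0; rewrite (exprD _ 2 2).
rewrite -/n in le_N *; set N := n%:R ^+ 2 in le_N *; set W := w_worm p w.
have -> : N * N * (W / Zworm) * Z set0 = N * W * (N * Z set0 / Zworm).
  by field; rewrite lt0r_neq0 ?Zworm_gt0.
apply: ler_peMr; first by rewrite mulr_ge0 ?w_worm_ge0 ?exprn_ge0.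
by rewrite ler_pdivlMr ?Zworm_gt0 // mul1r.
Qed.

End Weights.

(** * Bounding the congestion *)

Section Congestion.
Variables (R : realFieldType) (G : graph) (p : R).
Hypotheses (p_gt0 : 0 < p) (p_le_half : p <= 1 / 2).
Implicit Types (w x y T : {set edge G}).

Variable tail : {set edge G} -> seq {set edge G}.
Hypothesis tailP : forall D, D \in Omega G 0 ->
  [/\ path (@removes_edge G) D (tail D), last D (tail D) = set0
    & {subset D :: tail D <= Omega_worm G}].

(** Serves both bounds: [T = w] with [c = 1] in general, [T = symdiff w [set e]] with
    [c = p / (1 - p)] when [e] is added. *)
Lemma congestion_le w (e : edge G) T (c : R) :
    0 <= c ->
    (forall x y, x \in Omega G 0 -> y \in Omega G 0 ->
       uses_transition (canonical_path tail x y) w (symdiff w [set e]) ->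
       w_p p x * w_p p y = w_p p w * c * w_p p (symdiff (symdiff x y) T)) ->
  congestion p (canonical_path tail) w (symdiff w [set e])
    <= #|vertex G|%:R ^+ 4 * pi_worm p w * c.
Proof.
move=> c0 weightE; set w' := symdiff w [set e] in weightE *.
have n0 : (0 < #|vertex G|)%N by apply/card_gt0P; exists (ends e).1.
pose P (z : {set edge G} * {set edge G}) := (z.1 \in Omega G 0) &&
  ((z.2 \in Omega G 0) && uses_transition (canonical_path tail z.1 z.2) w w').
rewrite /congestion pair_big_dep /= -/P.
(* If no path uses the transition, the sum is 0 and [w] may lie outside [Omega_worm]; otherwise some
   path visits [w], which puts it in [Omega_worm]. *)
have [z0 Pz0 | noP] := pickP P; last first.
  rewrite big_pred0 //; apply: mulr_ge0 => //; apply: mulr_ge0.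
    exact: exprn_ge0.
  exact: pi_worm_ge0.
have wW : w \in Omega_worm G.
  by case/and3P: Pz0 => x0 y0 /(uses_transition_removes tailP x0 y0)[].
have Z0 := Z0_gt0 G p_gt0 p_le_half.
apply: le_trans (_ : w_p p w / Z p (set0 : {set vertex G}) * c <= _); last first.
  exact/ler_wpM2r/w_p_le_pi_worm.
pose h (z : {set edge G} * {set edge G}) := symdiff (symdiff z.1 z.2) T.
have inj_h : {in P &, injective h}.
  move=> [x y] [x' y'] /and3P[/= x0 y0 xy] /and3P[/= x0' y0' xy'] hE.
  have [-> ->] // := transition_encoding_inj tailP x0 y0 x0' y0' xy xy' hE.
(* The sets [h z] are distinct and, as [symdiff z.1 z.2] is even, have the odd vertices of [T]. *)
have sum_h : \sum_(z | P z) w_p p (h z) <= Z p (set0 : {set vertex G}).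
  rewrite -(big_imset _ inj_h) /=.
  apply: le_trans (Z_le p_gt0 p_le_half (odds T)).
  rewrite /Z big_mkcond [leRHS]big_mkcond /=; apply: ler_sum => S _.
  case: imsetP => [[[x y] /and3P[/= x0 y0 _] ->]|_]; last first.
    by case: ifP => // _; apply: w_p_ge0.
  by rewrite /h /= odds_even_symdiff ?eqxx // Omega0_symdiff.
have -> : \sum_(z | P z) pi_even p z.1 * pi_even p z.2
    = w_p p w * c / Z p (set0 : {set vertex G}) ^+ 2 * \sum_(z | P z) w_p p (h z).
  rewrite mulr_sumr; apply: eq_bigr => [[x y] /and3P[/= x0 y0 xy]].
  rewrite /pi_even x0 y0 ZOmega0 mulrACA (weightE _ _ x0 y0 xy) /h /=.
  by field; rewrite lt0r_neq0.
apply: le_trans (ler_wpM2l _ sum_h) _.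
  by rewrite divr_ge0 ?exprn_ge0 ?(ltW Z0) // mulr_ge0 // w_p_ge0.
by rewrite le_eqVlt; apply/orP; left; apply/eqP; field; rewrite lt0r_neq0.
Qed.

End Congestion.

Theorem theorem3p2 (R : realFieldType) (G : graph) (p : R)
    (p_gt0 : 0 < p) (p_le_half : p <= 1 / 2) :
  exists gamma : {set edge G} -> {set edge G} -> seq {set edge G},
    [/\ forall x y : {set edge G}, x \in Omega G 0 -> y \in Omega G 0 ->
          [/\ path_from_to x y (gamma x y),
              {subset gamma x y <= Omega_worm G},
              uniq (gamma x y)
            & (path_length (gamma x y) <= #|edge G|)%N],
        forall (w : {set edge G}) (e : edge G),
          congestion p gamma w (symdiff w [set e])
            <= #|vertex G|%:R ^+ 4 * pi_worm p w
      & forall (w : {set edge G}) (e : edge G), e \notin w ->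
          congestion p gamma w (w :|: [set e])
            <= #|vertex G|%:R ^+ 4 * pi_worm p w * (p / (1 - p))].
Proof.
(* Evenness is assumed under the existential so that [fin_all_exists] yields a total [tail],
   arbitrary outside [Omega G 0]. *)
have peelingP D : exists s, D \in Omega G 0 ->
    [/\ path (@removes_edge G) D s, last D s = set0
      & {subset D :: s <= Omega_worm G}].
  have [D0 | _] := boolP (D \in Omega G 0); last by exists [::].
  by have [|s sP] := @peeling_exists G D; [rewrite in_setU D0 | exists s].
have [tail tailP] := fin_all_exists peelingP.
exists (canonical_path tail); split=> [x y x0 y0|w e|w e ew].
- exact: canonical_pathP.
- rewrite -[leRHS]mulr1; apply: (congestion_le _ _ tailP (T := w)) => //.
  move=> x y x0 y0 /(uses_transition_removes tailP x0 y0)[_ wD _ _].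
  by rewrite mulr1 (w_pM p wD).
rewrite setU1_symdiff //.
apply: (congestion_le _ _ tailP (T := symdiff w [set e])) => //.
  by rewrite divr_ge0 ?(ltW p_gt0) // ltW // one_minus_p_gt0.
move=> x y x0 y0 /(uses_transition_removes tailP x0 y0)[ww' wD _ _].
have e_xyw : e \in symdiff (symdiff x y) w.
  suff: e \in symdiff x y by rewrite [in X in _ -> X]in_symdiff (negPf ew) addbF.
  apply: (subsetP wD).
  (* The transition flips only [e], so the edge [f] lost by the peeling is [e]. *)
  case/removes_edgeW/properP: ww' => _ [f]; rewrite symdiffA.
  rewrite ![f \in symdiff _ [set e]]in_symdiff inE.
  by have [<-|_] := eqVneq f e; rewrite ?addbF => // ->.
by rewrite (w_pM p wD) (w_pD1 p_le_half e_xyw) setD1_symdiff // symdiffA;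
   ring.
Qed.
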